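(* Let $n\ge 1$. For every integer $k\ge 0$, \[ \sum_{\substack{\sigma\in\mathcal{I}_n(321)\\ \mathrm{des}(\sigma)=k}} q^{\mathrm{maj}(\sigma)} = q^{k^2}{\lceil n/2\rceil \brack k}_q{\lfloor n/2\rfloor \brack k}_q , \] and for every integer $\ell$ with $1\le \ell\le \lfloor n/2\rfloor+1$, \[ \sum_{\substack{\sigma\in\mathcal{I}_n(321)\\ \mathrm{lead}(\sigma)=\ell}} q^{\mathrm{maj}(\sigma)} = \sum_{k\ge 0} q^{k^2+k\ell+\ell-1}{\lceil n/2\rceil-1 \brack k}_q{\lfloor n/2\rfloor-\ell+1 \brack k}_q . \]
   Context: $\mathfrak{S}_n$ is the set of permutations $\sigma=\sigma_1\cdots\sigma_n$ of $\{1,\dots,n\}$ in one-line notation. $\sigma$ is 321-avoiding if it has no decreasing subsequence of length three. $\mathcal{I}_n(321)$ denotes the set of involutions ($\sigma^{-1}=\sigma$) in $\mathfrak{S}_n$ that are 321-avoiding. The descent set is $\mathrm{Des}(\sigma)=\{i: 1\le i\le n-1,\ \sigma_i>\sigma_{i+1}\}$, $\mathrm{des}(\sigma)=|\mathrm{Des}(\sigma)|$, $\mathrm{maj}(\sigma)=\sum_{i\in\mathrm{Des}(\sigma)} i$, and $\mathrm{lead}(\sigma)=\sigma_1$. The $q$-binomial coefficient is ${m\brack k}_q=\frac{[m]!_q}{[k]!_q[m-k]!_q}$ for $0\le k\le m$ with $[m]!_q=[1]_q\cdots[m]_q$, $[i]_q=1+q+\cdots+q^{i-1}$, and ${m\brack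 k}_q=0$ if $k>m$. *)

(* Defs.v *)
From HB Require Import structures.
From mathcomp Require Import all_boot all_order all_algebra all_fingroup.
From mathcomp Require Import classical_sets fsbigop.

Set Implicit Arguments.
Unset Strict Implicit.
Unset Printing Implicit Defensive.

Import GRing.Theory.

(* A permutation of {1, ..., n} is an element s of 'S_n, which acts on
   {0, ..., n-1}; [oneline s] shifts the values back to {1, ..., n}. *)
Definition oneline (n : nat) (s : 'S_n) : seq nat :=
  [seq (s i).+1 | i <- enum 'I_n].

(* sigma_i, with 1-based index i (meaningful for 1 <= i <= n). *)
Definition entry (n : nat) (s : 'S_n) (i : nat) : nat :=
  nth 0 (oneline s) i.-1.

Definition avoids321 (n : nat) (s : 'S_n) : bool :=
  ~~ [exists i : 'I_n, exists j : 'I_n, exists k : 'I_n,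
        [&& i < j, j < k, s j < s i & s k < s j]].

Definition I321 (n : nat) : {set 'S_n} :=
  [set s : 'S_n | (s^-1 == s)%g && avoids321 s]%SET.

(* Members of 'I_n that are positive are exactly the positions 1, ..., n-1. *)
Definition Des (n : nat) (s : 'S_n) : {set 'I_n} :=
  [set i : 'I_n | (0 < i) && (entry s i > entry s i.+1)]%SET.

Definition des (n : nat) (s : 'S_n) : nat := #|Des s|.

Definition maj (n : nat) (s : 'S_n) : nat := \sum_(i in Des s) i.

Definition lead (n : nat) (s : 'S_n) : nat := entry s 1.

Section QBinomial.
Local Open Scope ring_scope.
Variables (F : fieldType) (q : F).

Definition qint (i : nat) : F := \sum_(j < i) q ^+ j.

Definition qfact (m : nat) : F := \prod_(1 <= i < m.+1) qint i.

Definition qbinom (m k : nat) : F :=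
  if (k <= m)%N then qfact m / (qfact k * qfact (m - k)) else 0.

End QBinomial.

(* The field Q(q), built as the fraction field of Z[q], and its
   indeterminate q; Z[q] embeds in it. *)
Definition Qq : fieldType := {fraction {poly int}}.

Definition qvar : Qq := tofrac ('X : {poly int})%R.

(* Main.v *)
(* Encode an involution s by the word with U (true) at the positions i < s i and
   D (false) elsewhere.  For a 321-avoiding involution arcs do not nest and fixed
   points lie under no arc, so s is the first-in-first-out matching of its word:
   the encoding is a bijection onto the words such that every U is matched.  It
   turns descents into factors UD (peaks) and lead s - 1 into the length of the
   initial run of U's.

   Reading a word from left to right, let the height be the number of pending
   U's; a D at height 0 leaves the height at 0.  The peak generating function of
   words ending at a given height satisfies a three-term recurrence with a
   reflecting boundary.  The closed form q^(ks + k^2) [a, k] [b, k], with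
   a + b = m and a - b = d, satisfies the same recurrence on the whole line and is
   even in d, so the method of images solves the reflecting problem.  The first
   identity is the case of words starting at height 0; for the second, delete the
   prefix U^(l-1) D and start at height max(l - 2, 0) with positions shifted by l. *)

Require Import Defs.
From mathcomp Require Import all_boot all_order all_algebra all_fingroup.
From mathcomp Require Import classical_sets fsbigop.
From mathcomp Require Import zify ring.

Set Implicit Arguments.
Unset Strict Implicit.
Unset Printing Implicit Defensive.
Import GRing.Theory.


(** * Words and their peaks *)

(** The truncated predecessor keeps the height at 0 on an unmatched D, which stands for a fixed
    point. *)
Definition hgt (h : nat) (w : seq bool) : nat :=
  foldl (fun h x => if x then h.+1 else h.-1) h w.

Lemma hgt_rcons h w x :
  hgt h (rcons w x) = if x then (hgt h w).+1 else (hgt h w).-1.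
Proof. by rewrite /hgt foldl_rcons. Qed.

(** The 0-based index of the D in a factor UD is the 1-based position of its U, so peaks are
    numbered like descents. *)
Definition peak (w : seq bool) (i : nat) : bool :=
  [&& 0 < i, nth false w i.-1 & ~~ nth false w i].

Definition npeaks (w : seq bool) : nat := \sum_(i < size w) peak w i.

(** The shift [s] stands for the length of a deleted prefix. *)
Definition wmaj (s : nat) (w : seq bool) : nat :=
  \sum_(i < size w) peak w i * (i + s).

Lemma peak_rcons w x i : i < size w -> peak (rcons w x) i = peak w i.
Proof.
move=> lt_i; rewrite /peak !nth_rcons lt_i.
by case: i lt_i => //= i lt_i; rewrite ltnW.
Qed.

Lemma peak_rcons_size w x : peak (rcons w x) (size w) = last false w && ~~ x.
Proof.
rewrite /peak !nth_rcons ltnn eqxx.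
case: (lastP w) => //= w' y; rewrite size_rcons /= ltnSn last_rcons.
by rewrite nth_rcons ltnn eqxx.
Qed.

Lemma npeaks_rcons w x : npeaks (rcons w x) = npeaks w + (last false w && ~~ x).
Proof.
rewrite /npeaks size_rcons big_ord_recr /= peak_rcons_size; congr addn.
by apply: eq_bigr => i _; rewrite peak_rcons.
Qed.

Lemma wmaj_rcons s w x :
  wmaj s (rcons w x) = wmaj s w + (last false w && ~~ x) * (size w + s).
Proof.
rewrite /wmaj size_rcons big_ord_recr /= peak_rcons_size; congr addn.
by apply: eq_bigr => i _; rewrite peak_rcons.
Qed.

Lemma npeaks_leq_size w : npeaks w <= size w.
Proof.
rewrite /npeaks -[X in _ <= X]card_ord -sum1_card.
by apply: leq_sum => i _; case: peak.
Qed.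

Lemma hgt_run r w : hgt 0 (nseq r true ++ false :: w) = hgt r.-1 w.
Proof.
rewrite /hgt foldl_cat /=; congr (foldl _ _.-1 w).
by rewrite -[RHS]addn0; elim: r {w} 0 => //= r IHr h; rewrite IHr addnS.
Qed.

Lemma wmaj_nseq s r : wmaj s (nseq r true) = 0.
Proof.
rewrite /wmaj big1 // => i _; rewrite /peak !nth_nseq.
by have := ltn_ord i; rewrite {2}size_nseq => ->; rewrite !andbF.
Qed.

(** The prefix ends in D, so no peak straddles the cut. Its own peak is at [r]; for [r = 0] there is
    none, and the term is 0 as well. *)
Lemma wmaj_run r w : wmaj 0 (nseq r true ++ false :: w) = r + wmaj r.+1 w.
Proof.
elim/last_ind: w => [|w x IHw].
  rewrite cats1 wmaj_rcons wmaj_nseq size_nseq andbT /wmaj big_ord0 !addn0.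
  by case: r => // r; rewrite -[r.+1]addn1 nseqD last_cat mul1n.
rewrite -rcons_cons -rcons_cat !wmaj_rcons IHw last_cat /= size_cat size_nseq.
by rewrite -!addnA; congr (_ + (_ + _ * _)); rewrite /=; lia.
Qed.

Fixpoint words (m : nat) : seq (seq bool) :=
  if m is m'.+1 then
    [seq rcons w true | w <- words m'] ++ [seq rcons w false | w <- words m']
  else [:: [::]].

Lemma mem_words m w : (w \in words m) = (size w == m).
Proof.
elim: m w => [|m IHm] w; first by rewrite inE size_eq0.
rewrite mem_cat; case: (lastP w) => [|w' x].
  by apply/negP => /orP[] /mapP[v _]; case: v.
rewrite size_rcons eqSS -IHm.
apply/orP/idP=> [[] /mapP[v v_m /rcons_inj[-> _]] // | w'_m].
by case: x; [left | right]; apply: map_f.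
Qed.

Lemma words_uniq m : uniq (words m).
Proof.
elim: m => //= m IHm; rewrite cat_uniq !map_inj_uniq ?IHm ?andbT; last 2 first.
- by move=> v w /rcons_inj[].
- by move=> v w /rcons_inj[].
by apply/hasPn=> _ /mapP[v _ ->]; apply/mapP=> -[w _ /rcons_inj[]].
Qed.

(** * Generating functions of words by final height and number of peaks *)

Section WordSums.
Local Open Scope ring_scope.
Variables (F : fieldType) (q : F) (s h0 : nat).

Definition wsum (m h k : nat) : F :=
  \sum_(w <- words m | (hgt h0 w == h) && (npeaks w == k)) q ^+ wmaj s w.

(** The share in [wsum m.+1 h k] of the words ending in D; a final U makes no peak and needs no sum
    of its own. *)
Let dsum (m h k : nat) : F :=
  \sum_(w <- words m | ((hgt h0 w).-1 == h) && (npeaks (rcons w false) == k))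
     q ^+ wmaj s (rcons w false).

Let wsumS m h k :
  wsum m.+1 h k = (if h is h'.+1 then wsum m h' k else 0) + dsum m h k.
Proof.
rewrite /wsum /= big_cat !big_map /=; congr (_ + _).
  case: h => [|h]; first by rewrite big1 // => w; rewrite hgt_rcons.
  apply: eq_big => [w | w _]; rewrite ?wmaj_rcons ?npeaks_rcons ?hgt_rcons andbF.
    by rewrite eqSS addn0.
  by rewrite addn0.
by apply: eq_bigl => w; rewrite hgt_rcons.
Qed.

(** Split by the letter before the final D. A U makes a peak at [m.+1] and cancels in height; after
    a D the final D adds no peak. *)
Let dsumS m h k :
  dsum m.+1 h k =
    (if k is k'.+1 then q ^+ (m.+1 + s) * wsum m h k' else 0)
    + dsum m h.+1 k + (if h is _.+1 then 0 else dsum m 0 k).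
Proof.
rewrite /dsum /= big_cat !big_map /= -addrA; congr (_ + _).
  case: k => [|k].
    by rewrite big1 // => w; rewrite npeaks_rcons last_rcons addn1 andbF.
  rewrite /wsum big_distrr /= big_seq_cond [RHS]big_seq_cond.
  apply: eq_big => [w | w /andP[w_m _]].
    by rewrite hgt_rcons !npeaks_rcons last_rcons andbF addn0 addn1 eqSS.
  rewrite !wmaj_rcons last_rcons size_rcons andbF -exprD; congr (_ ^+ _).
  by move: w_m; rewrite mem_words => /eqP ->; lia.
have dropD w : (npeaks (rcons (rcons w false) false) = npeaks (rcons w false))
  * (wmaj s (rcons (rcons w false) false) = wmaj s (rcons w false)).
  by rewrite npeaks_rcons wmaj_rcons last_rcons !addn0.
under eq_bigr => w _ do rewrite dropD.
under eq_bigl => w do rewrite hgt_rcons dropD.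
case: h => [|h].
  (* A predecessor is 0 at both 1 and 0; the second case is the boundary term. *)
  rewrite (bigID (fun w => (hgt h0 w).-1 == 1%N)) /=; congr (_ + _).
    apply: eq_bigl => w; case: (npeaks _ == k); rewrite ?andbF ?andbT //; lia.
  by apply: eq_bigl => w; case: (npeaks _ == k); rewrite ?andbF ?andbT //; lia.
rewrite addr0; apply: eq_bigl => w; congr (_ && _); lia.
Qed.

Lemma wsum0 h k : wsum 0 h k = ((h == h0) && (k == 0))%N%:R.
Proof.
rewrite /wsum big_mkcond big_seq1 /npeaks /wmaj /= !big_ord0 eq_sym [0%N == k]eq_sym.
by case: ifP.
Qed.

(** Second initial condition of the three-term recurrence; [h.-1] at [h = 0] accounts for the D read
    at height 0. *)
Lemma wsum1 h k : wsum 1 h k = wsum 0 h.-1 k + wsum 0 h.+1 k.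
Proof.
rewrite wsumS /dsum big_mkcond big_seq1 npeaks_rcons wmaj_rcons /= !wsum0.
rewrite /npeaks /wmaj !big_ord0 /= addn0 eq_sym.
case: k => [|k]; last first.
  by rewrite !andbF; case: h => [|h]; rewrite ?wsum0 ?andbF.
rewrite !andbT; case: h => [|h]; rewrite ?wsum0 ?andbT /=.
  case: {+}h0 => [|[|h']] //=; rewrite ?add0r ?addr0 //.
rewrite [h.+2 == h0]eq_sym; case: {+}h0 => [|h'] //=.
by rewrite eqSS [h' == _]eq_sym; case: (h.+1 == h').
Qed.

(* Words ending in UD are weighted as if they had no new peak by the second term;
   deleting their UD, the last two terms correct this. *)
Lemma wsumSS m h k :
  wsum m.+2 h k = wsum m.+1 h.-1 k + wsum m.+1 h.+1 k - wsum m h k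
    + (if k is k'.+1 then q ^+ (m.+1 + s) * wsum m h k' else 0).
Proof.
rewrite wsumS dsumS [wsum m.+1 h.+1 k]wsumS.
by case: h => [|h] /=; [rewrite [wsum m.+1 0 k]wsumS | ];
  clearbody dsum; case: k => [|k]; ring.
Qed.
End WordSums.

(** * 321-avoiding involutions as words *)

(* The arcs of a partial first-in-first-out matching of [true] letters with later
   [false] letters: [f] exchanges matched positions, and [O] is the queue of
   [true] letters still waiting for a partner. *)
Record fifo_matching (w : seq bool) (f : nat -> nat) (O : seq nat) : Prop :=
  FifoMatching {
    fifo_out : forall i, size w <= i -> f i = i;
    fifo_inv : involutive f;
    fifo_up : forall i, i < f i -> nth false w i;
    fifo_down : forall i, f i < i -> ~~ nth false w i;
    fifo_nest : forall i j, i < j -> i < f i -> j < f j -> f i < f j;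
    fifo_fixed : forall i j, i < j -> j < f i -> f j = j -> nth false w j;
    fifo_open : forall j, (j \in O) = (f j == j) && nth false w j;
    fifo_sorted : sorted ltn O;
    fifo_size : size O = hgt 0 w;
    fifo_queue : forall o i, o \in O -> i < f i -> i < o;
    fifo_fixed_open : forall o j, o \in O -> j < size w -> f j = j ->
      ~~ nth false w j -> j < o }.

Lemma fifo_matching_true w f O :
  fifo_matching w f O -> fifo_matching (rcons w true) f (rcons O (size w)).
Proof.
case=> out inv up down nest fixed open srt szO queue fixo.
have lt_f i : i < f i -> f i < size w.
  move=> lt_i; rewrite ltnNge; apply/negP => /out; rewrite inv => eq_i.
  by rewrite -eq_i ltnn in lt_i.
have lt_f' i : f i < i -> i < size w.
  by move=> lt_i; rewrite ltnNge; apply/negP => /out eq_i; rewrite eq_i ltnn in lt_i.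
have nthE i : i < size w -> nth false (rcons w true) i = nth false w i.
  by move=> lt_i; rewrite nth_rcons lt_i.
have O_lt o : o \in O -> o < size w.
  rewrite open => /andP[_ w_o]; rewrite ltnNge.
  by apply: contraL w_o => /(nth_default false) ->.
split=> //.
- by move=> i; rewrite size_rcons => /ltnW/out.
- by move=> i lt_i; rewrite nthE ?up // (ltn_trans lt_i) ?lt_f.
- by move=> i lt_i; rewrite nthE ?down ?lt_f'.
- move=> i j lt_ij lt_j fix_j; rewrite nthE ?(fixed i) //.
  by have := lt_f i; lia.
- move=> j; rewrite mem_rcons inE open nth_rcons.
  have [-> | ] := eqVneq j (size w); first by rewrite ltnn out ?eqxx.
  case: ltnP => // le_j _; by rewrite nth_default.
- case: O srt open O_lt {szO queue fixo} => //= o O srt open O_lt.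
  rewrite rcons_path srt; apply: O_lt; exact: mem_last.
- by rewrite size_rcons szO hgt_rcons.
- move=> o i; rewrite mem_rcons inE => /orP[/eqP -> lt_i|]; last exact: queue.
  exact: ltn_trans (lt_f _ lt_i).
- move=> o j; rewrite mem_rcons inE size_rcons ltnS leq_eqVlt nth_rcons.
  case/orP=> [/eqP -> | o_O] /orP[/eqP -> | lt_j]; rewrite ?ltnn ?eqxx ?lt_j //.
  by apply: fixo.
Qed.

Lemma fifo_matching_false_nil w f :
  fifo_matching w f [::] -> fifo_matching (rcons w false) f [::].
Proof.
case=> out inv up down nest fixed open srt szO queue fixo.
have lt_f i : i < f i -> f i < size w.
  move=> lt_i; rewrite ltnNge; apply/negP => /out; rewrite inv => eq_i.
  by rewrite -eq_i ltnn in lt_i.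
have nthE i : nth false (rcons w false) i = nth false w i.
  by rewrite nth_rcons; case: ltnP => [|/(nth_default false) ->] //; case: ifP.
split=> //; try by move=> *; rewrite nthE; auto.
- by move=> i; rewrite size_rcons => /ltnW/out.
- by move=> i j; rewrite nthE; apply: fixed.
- by rewrite hgt_rcons -szO.
Qed.

(** Serving the front [o] creates no nesting: by [fifo_queue] the older arcs open before [o], and
    they close before the new D. By [fifo_fixed_open] every fixed D of [w] lies before [o], hence
    not under the new arc. *)
Lemma fifo_matching_false_cons w f o O :
  fifo_matching w f (o :: O) ->
  fifo_matching (rcons w false)
    (fun i => if i == o then size w else if i == size w then o else f i) O.
Proof.
case=> out inv up down nest fixed open srt szO queue fixo.
set n := size w in out fixo *; set g := fun i => _.
have lt_f i : i < f i -> f i < n.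
  move=> lt_i; rewrite ltnNge; apply/negP => /out; rewrite inv => eq_i.
  by rewrite -eq_i ltnn in lt_i.
have nthE i : nth false (rcons w false) i = nth false w i.
  by rewrite nth_rcons; case: ltnP => [|/(nth_default false) ->] //; case: ifP.
have [fo w_o] : f o = o /\ nth false w o.
  by have := open o; rewrite mem_head => /esym/andP[/eqP].
have lt_on : o < n.
  by rewrite ltnNge; apply: contraL w_o => /(nth_default false) ->.
have o_lt p : p \in O -> o < p.
  by move: p; apply/allP; apply: order_path_min srt => //; exact: ltn_trans.
have f_eq_o i : f i = o -> i = o by move=> eq_o; rewrite -(inv i) eq_o fo.
have g_o : g o = n by rewrite /g eqxx.
have g_n : g n = o by rewrite /g eqxx; case: eqP => // ->.
have gE i : i != o -> i != n -> g i = f i by rewrite /g => /negPf -> /negPf ->.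
have g_up i : i < g i -> i = o \/ [/\ i <> o, i < n, g i = f i & i < f i].
  have [-> | ne_o] := eqVneq i o; first by left.
  have [-> | ne_n] := eqVneq i n; first by rewrite g_n; lia.
  rewrite gE // => lt_i; right; split=> //; first exact/eqP.
  exact: ltn_trans (lt_f _ lt_i).
split.
- move=> i; rewrite size_rcons => lt_i; rewrite gE ?out //; rewrite -/n in lt_i; lia.
- move=> i; have [-> | ne_o] := eqVneq i o; first by rewrite g_o g_n.
  have [-> | ne_n] := eqVneq i n; first by rewrite g_n g_o.
  rewrite (gE i) // gE ?inv //.
    by apply: contraNneq ne_o => /f_eq_o ->.
  by apply: contraNneq ne_n => fi; rewrite -(inv i) fi out.
- by move=> i /g_up[-> | [_ _ _ lt_i]]; rewrite nthE // up.
- move=> i; rewrite nthE; have [-> | ne_o] := eqVneq i o; first by rewrite g_o; lia.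
  have [-> | ne_n] := eqVneq i n; first by rewrite nth_default.
  by rewrite gE //; apply: down.
- move=> i j lt_ij /g_up[eq_i | [_ lt_i gi lt_fi]] /g_up[eq_j | [_ lt_j gj lt_fj]].
  + by lia.
  + by have := queue o j (mem_head _ _) lt_fj; lia.
  + by rewrite eq_j g_o gi lt_f.
  + by rewrite gi gj nest.
- move=> i j lt_ij lt_j; rewrite nthE.
  have [-> // | ne_o] := eqVneq j o.
  have [-> | ne_n] := eqVneq j n; first by rewrite g_n; lia.
  rewrite (gE j) // => fj.
  have /g_up[eq_i | [_ _ gi lt_fi]] : i < g i by lia.
    apply/negPn/negP => w_j; have := fixo o j (mem_head _ _) _ fj w_j.
    by move: lt_j; rewrite eq_i g_o => lt_j /(_ lt_j); lia.
  by apply: (fixed i); rewrite ?fj //; lia.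
- move=> j; rewrite nthE; have [-> | ne_o] := eqVneq j o.
    by rewrite g_o (_ : (n == o) = false) //=; [apply/negP => /o_lt; lia | lia].
  have [-> | ne_n] := eqVneq j n.
    rewrite nth_default // andbF; apply/negP => n_O.
    by have := open n; rewrite inE n_O orbT nth_default // andbF.
  by rewrite gE // -open inE (negPf ne_o).
- exact: path_sorted srt.
- by rewrite hgt_rcons -szO.
- move=> p i p_O /g_up[-> | [_ _ _ lt_fi]]; first exact: o_lt.
  by apply: queue; rewrite ?inE ?p_O ?orbT.
- move=> p j p_O; rewrite size_rcons nthE ltnS -/n.
  have [-> | ne_o] := eqVneq j o; first by rewrite w_o.
  have [-> | ne_n] := eqVneq j n; first by rewrite g_n; lia.
  rewrite gE // => le_j; apply: fixo; rewrite ?inE ?p_O ?orbT //; lia.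
Qed.

Lemma fifo_matching_exists w : exists f O, fifo_matching w f O.
Proof.
elim/last_ind: w => [|w x [f [O fO]]].
  exists id, [::]; split=> //.
  - by move=> i; rewrite ltnn.
  - by move=> i; rewrite ltnn.
  - by move=> i j lt_ij lt_ji; lia.
  - by move=> j; rewrite nth_nil andbF.
case: x; first by exists f, (rcons O (size w)); exact: fifo_matching_true.
case: O fO => [|o O] fO; first by exists f, [::]; exact: fifo_matching_false_nil.
by eexists; exists O; exact: fifo_matching_false_cons fO.
Qed.

(** * The word of an involution and its statistics *)

Definition excword (n : nat) (s : 'S_n) : seq bool :=
  [seq (i < s i) | i : 'I_n <- enum 'I_n].

Lemma size_excword n (s : 'S_n) : size (excword s) = n.
Proof. by rewrite size_map size_enum_ord. Qed.

Lemma nth_excword n (s : 'S_n) (i : 'I_n) : nth false (excword s) i = (i < s i).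
Proof. by rewrite (nth_map i) ?size_enum_ord // nth_ord_enum. Qed.

Lemma entryE n (s : 'S_n) (i : 'I_n) : entry s i.+1 = (s i).+1.
Proof. by rewrite /entry /oneline /= (nth_map i 0) ?size_enum_ord // nth_ord_enum. Qed.

(** Nested arcs give the pattern at [i], [j], [s j], and a fixed point [j] under an arc gives it at
    [i], [j], [s i]. Conversely, the middle of a pattern opens an arc, closes one or is fixed: the
    first two cases give nested arcs, the third a covered fixed point. *)
Lemma I321P n (s : 'S_n) :
  reflect [/\ involutive s,
              forall i j : 'I_n, i < j -> i < s i -> j < s j -> s i < s j
            & forall i j : 'I_n, i < j -> j < s i -> s j <> j]
          (s \in I321 n).
Proof.
rewrite inE; apply: (iffP andP) => [[/eqP sV avoid] | [s_inv nest fixed]].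
  have s_inv : involutive s by move=> i; rewrite -{1}sV permK.
  have no321 (i j k : 'I_n) : i < j -> j < k -> s j < s i -> s k < s j -> False.
    move=> lt_ij lt_jk lt_ji lt_kj; case/negP: avoid.
    apply/existsP; exists i; apply/existsP; exists j; apply/existsP; exists k.
    exact/and4P.
  split=> // [i j lt_ij lt_i lt_j | i j lt_ij lt_j fix_j].
    rewrite ltnNge leq_eqVlt; apply/negP => /orP[/eqP/val_inj/perm_inj eq_ij | lt_ji].
      by rewrite eq_ij ltnn in lt_ij.
    by apply: (no321 i j (s j)); rewrite ?s_inv.
  by apply: (no321 i j (s i)); rewrite ?s_inv ?fix_j.
split.
  by apply/eqP/permP => i; apply: (@perm_inj _ s); rewrite permKV s_inv.
apply/existsP => -[i /existsP[j /existsP[k /and4P[lt_ij lt_jk lt_ji lt_kj]]]].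
have [lt_j | lt_j | eq_j] := ltngtP j (s j).
- by have := nest i j lt_ij; lia.
- by have := nest (s k) (s j); rewrite !s_inv; lia.
- by apply: (fixed i j) => //; [lia | apply: val_inj].
Qed.

Section Involution321.
Variables (n : nat) (s : 'S_n).
Hypothesis s_I321 : s \in I321 n.

Let s_inv : involutive s. Proof. by case/I321P: s_I321. Qed.
Let nest (i j : 'I_n) : i < j -> i < s i -> j < s j -> s i < s j.
Proof. by case/I321P: s_I321 => _ + _; apply. Qed.
Let fixed (i j : 'I_n) : i < j -> j < s i -> s j <> j.
Proof. by case/I321P: s_I321 => _ _; apply. Qed.

(** Otherwise [s j < s i <= i < j], and the arc from [s j] to [j] covers the fixed point [i] or the
    arc of [i]. *)
Lemma I321_nonexc_mono (i j : 'I_n) : i < j -> s i <= i -> s j <= j -> s i < s j.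
Proof.
move=> lt_ij le_i le_j; rewrite ltnNge leq_eqVlt; apply/negP => /orP[/eqP | lt_ji].
  by move/val_inj/perm_inj => eq_ij; rewrite eq_ij ltnn in lt_ij.
move: le_i; rewrite leq_eqVlt => /orP[/eqP/val_inj fix_i | lt_i].
  rewrite fix_i in lt_ji.
  by apply: (fixed (i := s j) (j := i)) fix_i; rewrite ?s_inv.
by have := nest (i := s j) (j := s i); rewrite !s_inv; lia.
Qed.

(** UU rises since arcs do not nest, DD by [I321_nonexc_mono], DU trivially. For UD,
    [s j <= i + 1 <= s i], and injectivity excludes equality. *)
Lemma descent_excword (i j : 'I_n) : j = i.+1 :> nat ->
  (s j < s i) = (i < s i) && ~~ (j < s j).
Proof.
move=> eq_j; apply/idP/andP => [lt_ji | [lt_i]]; last first.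
  have /eqP : s i <> s j by move/perm_inj => eq_ij; rewrite eq_ij in eq_j; lia.
  by rewrite -val_eqE /=; lia.
have [le_i | lt_i] := leqP (s i) i.
  have [le_j | lt_j] := leqP (s j) j; last by lia.
  by have := I321_nonexc_mono (i := i) (j := j); lia.
split=> //; apply/negP => lt_j; have := nest (i := i) (j := j); lia.
Qed.

Lemma Des_excword (i : 'I_n) : (i \in Des s) = peak (excword s) i.
Proof.
rewrite inE /peak; case: i => [[|i] lt_i] //=.
pose i1 := Ordinal lt_i; pose i0 := Ordinal (ltnW lt_i).
rewrite (entryE s i0 : entry s i.+1 = _) (entryE s i1 : entry s i.+2 = _).
rewrite (nth_excword s i0 : nth _ _ i = _) (nth_excword s i1 : nth _ _ i.+1 = _).
by rewrite ltnS (descent_excword (i := i0) (j := i1)).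
Qed.

Lemma des_excword : des s = npeaks (excword s).
Proof.
rewrite /des -sum1_card /npeaks size_excword big_mkcond /=.
by apply: eq_bigr => i _; rewrite Des_excword; case: peak.
Qed.

Lemma maj_excword : maj s = wmaj 0 (excword s).
Proof.
rewrite /maj /wmaj size_excword big_mkcond /=.
by apply: eq_bigr => i _; rewrite Des_excword addn0; case: peak; rewrite ?mul1n.
Qed.

(* The leading arc starts at 1, so nothing below its endpoint can be fixed or
   close an arc. *)
Lemma lead_excword : 0 < n -> lead s = (find negb (excword s)).+1.
Proof.
move=> n_gt0; pose i0 := Ordinal n_gt0.
rewrite /lead -[1]/(nat_of_ord i0).+1 entryE; congr _.+1.
have not_r : ~~ nth false (excword s) (s i0) by rewrite nth_excword s_inv.
have lt_r (j : 'I_n) : j < s i0 -> nth false (excword s) j.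
  rewrite nth_excword => lt_j; have [eq_j | ne_j] := eqVneq j i0.
    by rewrite {1 2}eq_j (leq_ltn_trans _ lt_j).
  have lt0j : 0 < j by rewrite lt0n; move: ne_j; rewrite -val_eqE.
  rewrite ltnNge leq_eqVlt; apply/negP => /orP[/eqP/val_inj | lt_sj].
    by apply: (fixed (i := i0)).
  have [eq_sj | ne_sj] := eqVneq (s j) i0.
    by move: lt_j; rewrite -eq_sj s_inv ltnn.
  have := nest (i := i0) (j := s j); rewrite s_inv.
  by move: ne_sj; rewrite -val_eqE /=; lia.
have [lt_f | gt_f | -> //] := ltngtP (s i0) (find negb (excword s)).
  by have := before_find false lt_f; rewrite (negPf not_r).
have lt_n := ltn_trans gt_f (ltn_ord _).
have := nth_find false (a := negb) (s := excword s).
rewrite has_find size_excword -/(nat_of_ord (Ordinal lt_n)) => /(_ lt_n).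
by rewrite -[find _ _]/(nat_of_ord (Ordinal lt_n)) lt_r.
Qed.

Let pending i : {set 'I_n} := [set j : 'I_n | (j < i) && (i <= s j)].

(** An opener joins the pending set and a closer removes its partner. At a fixed point nothing is
    pending, since no arc covers it, so the truncated predecessor gives the right count. *)
Lemma hgt_take_excword i : i <= n -> hgt 0 (take i (excword s)) = #|pending i|.
Proof.
elim: i => [|i IHi] lt_i.
  by rewrite take0; apply/esym/eqP; rewrite cards_eq0; apply/eqP/setP => j; rewrite !inE.
pose o := Ordinal lt_i; have oE : i = o by [].
rewrite (take_nth false) ?size_excword // hgt_rcons IHi ?(ltnW lt_i) // {1}oE nth_excword.
have [lt_o | ge_o] := ltnP o (s o).
  have -> : pending i.+1 = o |: pending i.
    apply/setP => j; rewrite !inE -val_eqE /= ltnS [j <= i]leq_eqVlt.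
    have [eq_j | ne_j] := eqVneq (j : nat) i.
      by rewrite (_ : j = o); [exact: lt_o | exact: val_inj].
    case: (ltnP j i) => //= lt_j.
    have /eqP : s j <> o by move=> eq_j; move: lt_o; rewrite -eq_j s_inv /= eq_j /=; lia.
    by rewrite -val_eqE /=; lia.
  by rewrite cardsU1 inE /= ltnn.
have [fix_o | nfix_o] := eqVneq (s o) o.
  have pend0 : pending i = finset.set0.
    apply/setP => j; rewrite !inE; apply/andP => -[lt_j le_i].
    apply: (fixed (i := j) (j := o) _ _ fix_o) => //.
    have /eqP : s j <> o.
      by rewrite -{1}fix_o => /perm_inj eq_j; rewrite eq_j ltnn in lt_j.
    by rewrite -val_eqE /=; lia.
  have -> : pending i.+1 = pending i.
    rewrite pend0; apply/setP => j; rewrite !inE; apply/andP => -[lt_j le_i].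
    have : j \in pending i; last by rewrite pend0 inE.
    rewrite inE (ltnW le_i) andbT; move: lt_j; rewrite ltnS leq_eqVlt => /orP[/eqP eq_j|//].
    have eq_jo : j = o by apply: val_inj.
    by move: le_i; rewrite eq_jo fix_o /= ltnn.
  by rewrite pend0 cards0.
have lt_so : s o < o by move: nfix_o ge_o; rewrite -val_eqE /=; lia.
have -> : pending i = s o |: pending i.+1.
  apply/setP => j; rewrite !inE -val_eqE /= ltnS.
  have [eq_j | ne_j] := eqVneq (j : nat) (s o).
    by rewrite (val_inj eq_j) s_inv /= leqnn andbT.
  have /eqP : s j <> o by move=> eq_j; case/eqP: ne_j; rewrite -eq_j s_inv.
  have [eq_jo | ne_jo] := eqVneq (j : nat) i.
    by rewrite (_ : j = o); [move: lt_so => /=; lia | exact: val_inj].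
  by rewrite -val_eqE /=; lia.
by rewrite cardsU1 inE s_inv /= ltnn andbF.
Qed.

Lemma hgt_excword : hgt 0 (excword s) = 0.
Proof.
rewrite -[excword s]take_size size_excword hgt_take_excword //.
apply/eqP; rewrite cards_eq0; apply/eqP/setP => j; rewrite !inE.
by rewrite [n <= _]leqNgt (ltn_ord (s j)) andbF.
Qed.

End Involution321.

(** Let [i] be the least disagreement, with [s i < t i]. If [i] carries D, then [s] and [t] agree at
    [s i < i], forcing [t i = s i]. If it carries U, then [s i] carries D under the arc of [t] from
    [i]: [t] cannot fix it, and its partner cannot be [i], nor earlier by agreement, nor later
    without nesting. *)
Lemma excword_inj n : {in I321 n &, injective (@excword n)}.
Proof.
move=> s t /I321P[s_inv s_nest s_fix] /I321P[t_inv t_nest t_fix] eq_st.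
have exc (i : 'I_n) : (i < s i) = (i < t i) by rewrite -!nth_excword eq_st.
have agree m : forall i : 'I_n, i < m -> s i = t i.
  elim: m => // m IHm i; rewrite ltnS leq_eqVlt => /orP[/eqP eq_m | /IHm //].
  have {}IHm (j : 'I_n) : j < i -> s j = t j by rewrite eq_m; apply: IHm.
  wlog lt_st : s t s_inv s_nest s_fix t_inv t_nest t_fix eq_st exc IHm / s i < t i.
    move=> th; have [lt_st | lt_ts | /val_inj //] := ltngtP (s i) (t i).
      exact: th.
    by apply/esym; apply: th => // j /IHm.
  have [lt_si | le_si] := ltnP i (s i); last first.
    have le_ti : t i <= i by rewrite leqNgt -exc -leqNgt.
    have /IHm := leq_trans lt_st le_ti.
    by rewrite s_inv => eq_i; rewrite {2}eq_i t_inv.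
  have le_j : t (s i) <= s i by rewrite leqNgt -exc s_inv -leqNgt ltnW.
  case: (ltngtP (t (s i)) (s i)) le_j => // [lt_a _ | /val_inj fix_j _]; last first.
    by case: (t_fix i (s i)).
  case: (ltngtP (t (s i)) i) => [lt_ai | lt_ia | /val_inj eq_a].
  - by have := IHm _ lt_ai; rewrite t_inv => /perm_inj eq_a; rewrite eq_a ltnn in lt_ai.
  - by have := t_nest i (t (s i)); rewrite t_inv; lia.
  - by rewrite -{2}eq_a t_inv.
by apply/permP => i; apply: (agree n).
Qed.

(** Final height 0 means that the queue of the matching is empty: no U is fixed, so the U's are
    exactly the openers. *)
Lemma excword_onto n w : size w = n -> hgt 0 w = 0 ->
  exists2 s, s \in I321 n & excword s = w.
Proof.
move=> szw h0; have [f [O [out inv up down nest fixed open _ szO _ _]]] :=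
  fifo_matching_exists w.
rewrite h0 in szO; rewrite szw in out.
have f_lt i : i < n -> f i < n.
  move=> lt_i; rewrite ltnNge; apply/negP => le_f.
  by have := out _ le_f; rewrite inv; lia.
pose g (i : 'I_n) : 'I_n := Ordinal (f_lt i (ltn_ord i)).
have g_inv : involutive g by move=> i; apply: val_inj; rewrite /= inv.
have w_exc i : nth false w i = (i < f i).
  apply/idP/idP => [w_i | /up //]; have [ // | lt_i | eq_i] := ltngtP i (f i).
    by have := down i lt_i; rewrite w_i.
  by have := open i; rewrite -eq_i eqxx w_i (size0nil szO).
exists (perm (inv_inj g_inv)).
  apply/I321P; split=> [i | i j | i j lt_ij]; rewrite !permE //=.
    exact: nest.
  move=> lt_j /(congr1 val) /= fj.
  by have := fixed _ _ lt_ij lt_j fj; rewrite w_exc fj ltnn.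
apply: (@eq_from_nth _ false); rewrite size_excword // => i lt_i.
by rewrite -[i]/(nat_of_ord (Ordinal lt_i)) nth_excword permE /= w_exc.
Qed.

Lemma perm_excword n :
  perm_eq [seq excword s | s <- enum (I321 n)] [seq w <- words n | hgt 0 w == 0].
Proof.
apply: uniq_perm.
- rewrite map_inj_in_uniq ?enum_uniq // => s t; rewrite !mem_enum; exact: excword_inj.
- exact/filter_uniq/words_uniq.
move=> w; rewrite mem_filter mem_words; apply/mapP/andP => [[s] | [/eqP h0 /eqP szw]].
  by rewrite mem_enum => s_I ->; rewrite hgt_excword // size_excword.
by have [s s_I <-] := excword_onto szw h0; exists s; rewrite ?mem_enum.
Qed.

(** * The closed form and the method of images *)

Section QBinomialTheory.
Local Open Scope ring_scope.
Variables (F : fieldType) (q : F).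

Lemma qint_add a b : qint q (a + b) = qint q a + q ^+ a * qint q b.
Proof.
rewrite /qint big_split_ord /= big_distrr /=; congr (_ + _).
by apply: eq_bigr => i _; rewrite exprD.
Qed.

Lemma qfactS m : qfact q m.+1 = qfact q m * qint q m.+1.
Proof. by rewrite /qfact big_nat_recr. Qed.

Lemma qfact0 : qfact q 0 = 1.
Proof. by rewrite /qfact big_geq. Qed.

Hypothesis qint_neq0 : forall i, qint q i.+1 != 0.

Lemma qfact_neq0 m : qfact q m != 0.
Proof. by elim: m => [|m IHm]; rewrite ?qfact0 ?oner_neq0 // qfactS mulf_neq0. Qed.

Lemma qbinom0 m : qbinom q m 0 = 1.
Proof. by rewrite /qbinom /= subn0 qfact0 mul1r divff ?qfact_neq0. Qed.

Lemma qbinom_small m k : (m < k)%N -> qbinom q m k = 0.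
Proof. by rewrite /qbinom ltnNge => /negPf ->. Qed.

(** The q-Pascal rule obtained by splitting [m+1] as [m-k] + q^(m-k) [k+1]. *)
Lemma qbinomS m k :
  qbinom q m.+1 k.+1 = qbinom q m k.+1 + q ^+ (m - k) * qbinom q m k.
Proof.
have [lt_mk | le_km] := ltnP m k.
  by rewrite !qbinom_small ?ltnS //; [ring | lia].
rewrite /qbinom ltnS le_km subSS.
have [d ->] : exists d, m = (k + d)%N by exists (m - k)%N; lia.
rewrite addKn; case: d => [|d].
  rewrite addn0 ltnn qfact0 add0r !mulr1 expr0 mul1r.
  by rewrite !divff ?qfact_neq0.
rewrite (_ : (k < k + d.+1)%N) ?addnS ?subSS ?addKn; last by lia.
rewrite qfactS [qfact q k.+1]qfactS [qfact q d.+1]qfactS.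
have -> : qint q (k + d).+2 = qint q d.+1 + q ^+ d.+1 * qint q k.+1.
  by rewrite -qint_add; congr qint; lia.
have := qint_neq0 d; have := qint_neq0 k; have := qfact_neq0 k; have := qfact_neq0 d.
by move=> *; field; apply/and4P.
Qed.

(** MacMahon's count, by peaks, of words with [a] U's and [b] D's and no boundary. The value 0 at
    negative integers lets the recurrence hold on the whole line. *)
Definition qbox (s : nat) (a b : int) (k : nat) : F :=
  match a, b with
  | Posz a, Posz b => q ^+ (k * s + k ^ 2) * qbinom q a k * qbinom q b k
  | _, _ => 0
  end.

Lemma qboxC s a b k : qbox s a b k = qbox s b a k.
Proof. by case: a b => [a|a] [b|b] //=; rewrite mulrAC. Qed.

(* The mixed difference of a product is the product of the differences. *)
Lemma qboxSS {s m} {a b : int} {k} : a + b = m%:Z + 2 ->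
  qbox s a b k = qbox s (a - 1) b k + qbox s a (b - 1) k - qbox s (a - 1) (b - 1) k
    + (if k is k'.+1 then q ^+ (m.+1 + s) * qbox s (a - 1) (b - 1) k' else 0).
Proof.
(* As [a + b >= 2], this makes [b] positive, so only [a] can leave the quadrant. *)
wlog le_ab : k a b / a <= b => [th_sym | ].
  have [/(th_sym k) //|le_ba] : a <= b \/ b <= a by lia.
  rewrite addrC qboxC => /(th_sym k _ _ le_ba) ->.
  rewrite [qbox s (b - 1) a k]qboxC [qbox s b (a - 1) k]qboxC.
  rewrite [qbox s (b - 1) (a - 1) k]qboxC.
  by case: k => [|k]; rewrite ?[qbox s (b - 1) _ _]qboxC; ring.
case: a le_ab => [[|a]|a] le_ab.
- case: b le_ab => [[|[|b]]|b] _ eq_m; [exfalso; lia | exfalso; lia | | exfalso; lia].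
rewrite (_ : b.+2%:Z - 1 = b.+1%:Z); last by lia.
  rewrite (_ : 0%:Z - 1 = Negz 0) //=.
  case: k => [|k]; first by rewrite !qbinom0; ring.
  by rewrite (qbinom_small (m := 0)) //; ring.
- case: b le_ab => [[|b]|b] le_ab eq_m; try by exfalso; lia.
  rewrite (_ : b.+1%:Z - 1 = b%:Z); last by lia.
  rewrite (_ : a.+1%:Z - 1 = a%:Z); last by lia.
  have -> : m = (a + b)%N by lia.
  rewrite /=; case: k => [|k]; first by rewrite !qbinom0; ring.
  have [lt_ak | le_ka] := ltnP a k.
    by rewrite !(qbinom_small (m := a)) ?(qbinom_small (m := a.+1)) //; [ring | lia].
  have [lt_bk | le_kb] := ltnP b k.
    by rewrite !(qbinom_small (m := b)) ?(qbinom_small (m := b.+1)) //; [ring | lia].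
  rewrite !qbinomS.
  set A := qbinom q a k; set B := qbinom q b k.
  set A' := qbinom q a k.+1; set B' := qbinom q b k.+1.
  (* The terms in [k] cancel: (k+1)^2 + (a-k) + (b-k) = k^2 + a + b + 1, so the coefficient of the
     index [k] term depends only on [m = a + b] and [s]. *)
  have expE : q ^+ (k.+1 * s + k.+1 ^ 2) * (q ^+ (a - k) * q ^+ (b - k)) =
              q ^+ ((a + b).+1 + s) * q ^+ (k * s + k ^ 2).
    by rewrite -!exprD; congr (_ ^+ _); nia.
  by transitivity (q ^+ (k.+1 * s + k.+1 ^ 2) * (A' * B' + q ^+ (a - k) * A * B'
     + A' * (q ^+ (b - k) * B))
     + q ^+ (k.+1 * s + k.+1 ^ 2) * (q ^+ (a - k) * q ^+ (b - k)) * (A * B));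
   [ring | rewrite expE; ring].
- rewrite (_ : Negz a - 1 = Negz a.+1) /=; last by lia.
  by move=> _; case: k => [|k]; ring.
Qed.

(** [qbox] in the coordinates length [m = a + b] and height change [d = a - b], which must have
    equal parity. *)
Definition boxsum (s m : nat) (d : int) (k : nat) : F :=
  if ((m%:Z + d) %% 2)%Z == 0 then qbox s ((m%:Z + d) %/ 2)%Z ((m%:Z - d) %/ 2)%Z k
  else 0.

Lemma boxsumE {s m} {a b d : int} {k} :
  a + b = m%:Z -> a - b = d -> boxsum s m d k = qbox s a b k.
Proof.
move=> ab_m <-; rewrite /boxsum -ab_m (_ : a + b + (a - b) = a * 2) ?modzMl; last by ring.
by rewrite (_ : a + b - (a - b) = b * 2) ?mulzK //; ring.
Qed.

Lemma boxsum_odd {s m} {c d : int} {k} : m%:Z + d = c * 2 + 1 -> boxsum s m d k = 0.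
Proof. by rewrite /boxsum => ->; rewrite modzMDl. Qed.

Lemma int_parity (d : int) : exists c, d = c * 2 \/ d = c * 2 + 1.
Proof.
exists (d %/ 2)%Z; rewrite {1 3}(divz_eq d 2).
have := ltz_pmod d (isT : 0 < 2%:Z); have := modz_ge0 d (isT : 2%:Z != 0).
by case: (_ %% _)%Z => [[|[|c]]|c] // _ _; [left; rewrite addr0 | right].
Qed.

Lemma boxsumN s m d k : boxsum s m (- d) k = boxsum s m d k.
Proof.
have [c [def_c | def_c]] := int_parity (m%:Z + d).
  rewrite (boxsumE (d := d) (a := c) (b := m%:Z - c)); try lia.
  by rewrite (boxsumE (a := m%:Z - c) (b := c)) 1?qboxC //; lia.
by rewrite (boxsum_odd (d := d) (c := c)) ?(boxsum_odd (c := m%:Z - c - 1)) //; lia.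
Qed.

Lemma boxsumSS s m d k :
  boxsum s m.+2 d k = boxsum s m.+1 (d - 1) k + boxsum s m.+1 (d + 1) k - boxsum s m d k
    + (if k is k'.+1 then q ^+ (m.+1 + s) * boxsum s m d k' else 0).
Proof.
have [c [def_c | def_c]] := int_parity (m%:Z + d); last first.
  have odd_m k' : boxsum s m d k' = 0 by apply: boxsum_odd def_c.
  rewrite (boxsum_odd (m := m.+2) (c := c + 1)); last by lia.
  rewrite (boxsum_odd (m := m.+1) (c := c)); last by lia.
  rewrite (boxsum_odd (m := m.+1) (c := c + 1)); last by lia.
  by case: k => [|k]; rewrite !odd_m; ring.
(* These solve [a + b = m + 2] and [a - b = d], given [m + d = 2c]. *)
pose a := c + 1; pose b := m%:Z + 1 - c.
have mE k' : boxsum s m d k' = qbox s (a - 1) (b - 1) k' by apply: boxsumE; lia.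
rewrite (boxsumE (m := m.+2) (a := a) (b := b)); try lia.
rewrite (boxsumE (m := m.+1) (a := a - 1) (b := b)); try lia.
rewrite (boxsumE (m := m.+1) (a := a) (b := b - 1)); try lia.
by rewrite (qboxSS (m := m)) ?mE //; [case: k => [|k]; rewrite ?mE | lia].
Qed.

Lemma boxsum0 s d k : boxsum s 0 d k = ((d == 0) && (k == 0%N))%:R.
Proof.
have [c [-> | ->]] := int_parity d; last first.
  rewrite (boxsum_odd (c := c)); last by lia.
  by rewrite (_ : (c * 2 + 1 == 0) = false) //; lia.
rewrite (boxsumE (a := c) (b := - c)); try lia.
have -> : (c * 2 == 0) = (c == 0) by lia.
case: c => [[|a]|a] //=; case: k => [|k].
  by rewrite !qbinom0 !mulr1.
by rewrite (qbinom_small (m := 0)) // mulr0.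
Qed.

Lemma boxsum1 s d k : boxsum s 1 d k = boxsum s 0 (d - 1) k + boxsum s 0 (d + 1) k.
Proof.
rewrite !boxsum0; have [c [-> | ->]] := int_parity d.
  rewrite (boxsum_odd (c := c)); last by lia.
  have -> : (c * 2 - 1 == 0) = false by lia.
  have -> : (c * 2 + 1 == 0) = false by lia.
  by rewrite addr0.
rewrite (boxsumE (a := c + 1) (b := - c)); try lia.
have -> : (c * 2 + 1 - 1 == 0) = (c == 0) by lia.
have -> : (c * 2 + 1 + 1 == 0) = (c == -1) by lia.
case: c => [[|a]|[|a]] /=; rewrite ?addr0 ?add0r //.
all: case: k => [|k] //=.
all: by rewrite ?qbinom0 ?(qbinom_small (m := 0)) ?mulr0 ?mul0r ?mul0n ?mulr1.
Qed.

End QBinomialTheory.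

Section WordSumsBox.
Local Open Scope ring_scope.
Variables (F : fieldType) (q : F).
Hypothesis qint_neq0 : forall i, qint q i.+1 != 0.

(* Method of images: both terms obey the recurrence of [wsum], and the second is
   the reflection of the first across -1/2, where [wsum] has its boundary. *)
Lemma wsum_boxsum s h0 m h k :
  wsum q s h0 m h k =
  boxsum q s m (h%:Z - h0%:Z) k + boxsum q s m (h%:Z + h0%:Z + 1) k.
Proof.
pose img m (h : int) k := boxsum q s m (h - h0%:Z) k + boxsum q s m (h + h0%:Z + 1) k.
rewrite -[RHS]/(img m h%:Z k).
(* The two terms of [img] swap under h -> -1 - h, so [img] agrees at -1 and 0: this is the boundary
   condition hidden in [h'.-1]. *)
have imgP m' h' k' : img m' (h'.-1)%:Z k' = img m' (h'%:Z - 1) k'.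
  case: h' => [|h']; last by congr img; lia.
  rewrite /img addrC -[boxsum q s m' (_ + _ + 1) k']boxsumN.
  rewrite -[boxsum q s m' (_ - _) k' in LHS]boxsumN.
  by congr (boxsum _ _ _ _ _ + boxsum _ _ _ _ _); lia.
have imgS m' (h' : nat) k' : img m' (h'%:Z + 1) k' = img m' h'.+1%:Z k'.
  by congr img; lia.
have img1 (h' : int) k' : img 1%N h' k' = img 0 (h' - 1) k' + img 0 (h' + 1) k'.
  rewrite /img !(boxsum1 qint_neq0) addrACA.
  by congr (boxsum _ _ _ _ _ + boxsum _ _ _ _ _
    + (boxsum _ _ _ _ _ + boxsum _ _ _ _ _)); lia.
have imgSS m' (h' : int) k' :
    img m'.+2 h' k' = img m'.+1 (h' - 1) k' + img m'.+1 (h' + 1) k' - img m' h' k'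
      + (if k' is k''.+1 then q ^+ (m'.+1 + s) * img m' h' k'' else 0).
  rewrite /img !(boxsumSS qint_neq0).
  rewrite (_ : h' - 1 - h0%:Z = h' - h0%:Z - 1); last by ring.
  rewrite (_ : h' + 1 - h0%:Z = h' - h0%:Z + 1); last by ring.
  rewrite (_ : h' - 1 + h0%:Z + 1 = h' + h0%:Z + 1 - 1); last by ring.
  rewrite (_ : h' + 1 + h0%:Z + 1 = h' + h0%:Z + 1 + 1); last by ring.
  by case: k' => [|k']; ring.
have wsum_img0 h' k' : wsum q s h0 0 h' k' = img 0 h'%:Z k'.
  rewrite wsum0 /img !(boxsum0 qint_neq0).
  have -> : (h'%:Z - h0%:Z == 0) = (h' == h0) by lia.
  by rewrite (_ : (h'%:Z + h0%:Z + 1 == 0) = false) ?addr0 //; lia.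
suff [] : (forall h k, wsum q s h0 m h k = img m h%:Z k) /\
          (forall h k, wsum q s h0 m.+1 h k = img m.+1 h%:Z k) by [].
elim: m => [|m [IHm IHm1]]; split=> // h' k'.
  by rewrite wsum1 !wsum_img0 img1 imgP imgS.
by rewrite wsumSS imgSS -imgP imgS !IHm1 !IHm; case: k' => [|k']; rewrite ?IHm.
Qed.

(** At final height 0 the images sit at distances [h0] and [h0 + 1], of opposite parity, so exactly
    one survives. *)
Lemma wsum_qbox {s h0 m} {a b : nat} {k} : (m = a + b)%N ->
  (a = b + h0)%N \/ (a = b + h0 + 1)%N ->
  wsum q s h0 m 0 k = qbox q s a b k.
Proof.
move=> def_m [] def_a; rewrite wsum_boxsum sub0r boxsumN add0r.
  rewrite (boxsumE q (a := a%:Z) (b := b%:Z)); try lia.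
  by rewrite (boxsum_odd q (c := a%:Z)) ?addr0 //; lia.
rewrite (boxsum_odd q (c := a%:Z - 1)); last by lia.
by rewrite add0r; apply: boxsumE; lia.
Qed.

End WordSumsBox.

(** * Splitting off the initial run of U's *)

Lemma find_negb_run r w : find negb (nseq r true ++ false :: w) = r.
Proof. by elim: r => //= r ->. Qed.

Lemma run_find_negb w : find negb w < size w ->
  w = nseq (find negb w) true ++ false :: drop (find negb w).+1 w.
Proof. by elim: w => [|[] w IHw] //=; rewrite ?drop0 // ltnS => /IHw {1}->. Qed.

Lemma perm_words_run n r : r < n ->
  perm_eq [seq w <- words n | find negb w == r]
          [seq nseq r true ++ false :: w | w <- words (n - r.+1)].
Proof.
move=> lt_rn; apply: uniq_perm; first exact/filter_uniq/words_uniq.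
  rewrite map_inj_uniq ?words_uniq // => v w.
  by move/eqP; rewrite eqseq_cat // => /andP[_ /eqP[]].
move=> w; rewrite mem_filter mem_words; apply/andP/mapP => [[/eqP fw /eqP szw]|[v]].
  have := run_find_negb (w := w); rewrite fw szw => /(_ lt_rn) ->.
  by eexists; last reflexivity; rewrite mem_words size_drop szw.
rewrite mem_words => /eqP szv ->; rewrite find_negb_run size_cat size_nseq /= szv.
by split=> //; lia.
Qed.

(** The underlying polynomial has constant coefficient 1. *)
Lemma qint_qvar_neq0 i : (qint qvar i.+1 != 0)%R.
Proof.
have -> : qint qvar i.+1 = tofrac (\sum_(j < i.+1) 'X^j : {poly int})%R.
  by rewrite rmorph_sum; apply: eq_bigr => j _; rewrite rmorphXn.
rewrite tofrac_eq0; apply/negP => /eqP/(congr1 (fun p : {poly int} => p`_0)%R).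
rewrite coef_sum big_ord_recl coefXn big1 ?coef0 // => j _.
by rewrite coefXn.
Qed.

Lemma sum_I321_words n (P : pred (seq bool)) :
  (\sum_(s in I321 n | P (excword s)) qvar ^+ maj s =
   \sum_(w <- words n | (hgt 0 w == 0%N) && P w) qvar ^+ wmaj 0 w)%R.
Proof.
rewrite -[RHS]big_filter_cond -(perm_big _ (perm_excword n)) big_map big_enum_cond.
by apply: eq_bigr => s /andP[s_I _]; rewrite maj_excword.
Qed.

Local Open Scope ring_scope.

Theorem theorem1p4 (n : nat) (hn : (1 <= n)%N) :
  (forall k : nat,
     \sum_(s in I321 n | des s == k) qvar ^+ maj s
     = qvar ^+ (k ^ 2)%N * qbinom qvar (uphalf n) k * qbinom qvar n./2 k)
  /\
  (forall l : nat, (1 <= l <= n./2 + 1)%N ->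
     \sum_(s in I321 n | lead s == l) qvar ^+ maj s
     = \sum_(k \in [set: nat]%classic)
         qvar ^+ (k ^ 2 + k * l + l - 1)%N
         * qbinom qvar (uphalf n - 1)%N k
         * qbinom qvar (n./2 + 1 - l)%N k).
Proof.
have n_half := odd_double_half n; have n_uphalf := uphalf_half n.
have odd_le1 := leq_b1 (odd n).
split=> [k | [//|r] /= le_r].
  transitivity (wsum qvar 0 0 n 0 k).
    rewrite /wsum -(sum_I321_words _ (fun w => npeaks w == k)); apply: eq_bigl => s.
    by case s_I: (s \in I321 n) => //=; rewrite des_excword.
  (* The two halves of [n] differ by 0 or 1, the two admissible values for [h0 = 0]. *)
  rewrite (wsum_qbox qint_qvar_neq0 (a := uphalf n) (b := n./2)) /= ?muln0 ?add0n //.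
    by rewrite -muln2 in n_half; lia.
  by lia.
have lt_rn : (r < n)%N by lia.
(* With [l = r + 1], [m] is the length left after deleting U^r D, and [a + b = m]. *)
pose m := (n - r.+1)%N; pose a := (uphalf n - 1)%N; pose b := (n./2 + 1 - r.+1)%N.
have wsumE k : wsum qvar r.+1 r.-1 m 0 k = qbox qvar r.+1 a b k.
  (* The parity of [n] makes [a - b] equal to [r - 1] or [r]. For [r = 0] and even [n] it is -1, so
     [a] and [b] are exchanged. *)
  have [r0 | r_gt0] := posnP r; last first.
    by apply: wsum_qbox; [exact: qint_qvar_neq0 | lia | lia].
  case odd_n : (odd n).
    by apply: wsum_qbox; [exact: qint_qvar_neq0 | lia | lia].
  by rewrite qboxC; apply: wsum_qbox; [exact: qint_qvar_neq0 | lia | lia].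
transitivity (\sum_(w <- words m | hgt r.-1 w == 0%N) qvar ^+ (r + wmaj r.+1 w)).
  transitivity (\sum_(s in I321 n | find negb (excword s) == r) qvar ^+ maj s).
    by apply: eq_bigl => s; case s_I: (s \in I321 n) => //=; rewrite lead_excword.
  rewrite (sum_I321_words _ (fun w => find negb w == r)).
  under eq_bigl => w do rewrite andbC.
  rewrite -big_filter_cond (perm_big _ (perm_words_run lt_rn)) big_map.
  by apply: eq_big => [w | w _]; rewrite ?hgt_run ?wmaj_run.
transitivity (\sum_(k < m.+1) qvar ^+ r * wsum qvar r.+1 r.-1 m 0 k).
  rewrite -big_distrr /= /wsum.
  under eq_bigr do rewrite exprD.
  rewrite -big_distrr /=; congr (_ * _).
  (* A word of length [m] has at most [m] peaks, so [inord] never falls back to its default. *)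
  rewrite big_seq_cond (partition_big (fun w => inord (npeaks w) : 'I_m.+1) predT) //=.
  apply: eq_bigr => k _; rewrite [RHS]big_seq_cond; apply: eq_bigl => w.
  case w_m: (w \in words m) => //=; rewrite -val_eqE /= inordK // ltnS.
  by move: w_m; rewrite mem_words => /eqP <-; exact: npeaks_leq_size.
(* The bound on [r] gives [a <= m], so the terms with [k > m] vanish. *)
rewrite -(fsbig_widen `I_m.+1 [set: nat]%classic) //=; last first.
  move=> k [_ /= /negP]; rewrite -leqNgt => le_k.
  by rewrite (@qbinom_small _ _ a) ?mulr0 ?mul0r // /a; lia.
rewrite -fsbig_ord; apply: eq_bigr => k _.
rewrite wsumE /qbox !mulrA -exprD.
by congr (_ ^+ _ * _ * _); lia.
Qed.
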